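(* Let $M$ be an $L$-structure and $\phi(x,y)$ an $L$-formula. Let $N\succeq N_0\succeq M$ and let $p\in S_{\phi(x)}(N_0)$ be finitely satisfiable in $M$. Then there exists $q\in S_{\phi(x)}(N)$ that extends $p$ and is also finitely satisfiable in $M$.
   Context: Logic: We work in continuous (metric) first-order logic with values in $\mathfrak V=\ell^\infty(\omega)$ (real Banach space), with metric $\mathfrak d(\mathfrak r,\mathfrak s)=\|\mathfrak r-\mathfrak s\|_\infty$; an isometric copy $\mathbb R\hookrightarrow\mathfrak V$ is fixed. It is set up as standard $[0,1]$-valued continuous logic (complete metric structures, possibly many-sorted, symbols with prescribed moduli of uniform continuity), except that each predicate symbol $P$ of the language $L$ comes with a compact set $K_P\subseteq\mathfrak V$ in which it takes values; connectives are all continuous functions $u:\mathfrak V^n\to\mathfrak V$; and $\sup_x\psi$, $\inf_x\psi$ are formed only for formulas $\psi$ with value set $K_\psi\subseteq\mathbb R^{\geq0}$. Inductively each formula $\phi$ has a compact value set $K_\phi\subseteq\mathfrak V$ ($K_{u(\phi_0,\ldots,\phi_{n-1})}=u(\prod_i K_{\phi_i})$, and $K_{\sup_x\psi}=K_{\inf_x\psi}=K_\psi$), and $\phi^M$ takes values in $K_\phi$ in every $L$-structure $M$. Here $x,y$ are tuples of variables and $M^x$ is the product of sorts of $M$ corresponding to $x$. $N\succeq M$ means $N$ is an elementary extension of $M$. Types: $S_{\phi(x)}(N)$ is the set of complete $\phi(x)$-types over $N$. A type $p\in S_{\phi(x)}(N)$ is determined by the function $b\mapsto\phi(p,b)$ from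 $N^y$ to $K_\phi$, where $\phi(p,b)=\phi^{N'}(a,b)$ for any realization $a\in N'^x$ of $p$ in some $N'\succeq N$. For $N\succeq N_0$, $q\in S_{\phi(x)}(N)$ extends $p\in S_{\phi(x)}(N_0)$ if $\phi(q,b)=\phi(p,b)$ for all $b\in N_0^y$. Finite satisfiability: for $N\succeq M$, a type $p\in S_{\phi(x)}(N)$ is finitely satisfiable in $M$ if, for every $n<\omega$, $b_0,\ldots,b_{n-1}\in N^y$ and $\delta>0$, there is some $a\in M^x$ such that $\mathfrak d(\phi^N(a,b_i),\phi(p,b_i))<\delta$ for all $i<n$. *)

(* Defs.v *)
(* Continuous logic with values in l^oo(nat). *)
From HB Require Import structures.
From mathcomp Require Import all_boot all_order all_algebra.
From mathcomp Require Import all_classical all_reals all_analysis.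

Set Implicit Arguments.
Unset Strict Implicit.
Unset Printing Implicit Defensive.

Import Order.TTheory GRing.Theory Num.Theory.
Import numFieldNormedType.Exports.

Local Open Scope classical_set_scope.
Local Open Scope ring_scope.

Section Linfty.
Variable R : realType.

Definition bounded_seq : {pred nat -> R} :=
  fun u : nat -> R => `[< exists B, forall n, `|u n| <= B >].

Lemma bounded_seqP (u : nat -> R) :
  reflect (exists B, forall n, `|u n| <= B) (u \in bounded_seq).
Proof. exact: asboolP. Qed.

Lemma bounded_seq_submod : subsemimod_closed bounded_seq.
Proof.
split; first split.
- by apply/bounded_seqP; exists 0 => n; rewrite normr0.
- move=> u v /bounded_seqP[B uB] /bounded_seqP[C vC].
  apply/bounded_seqP; exists (B + C) => n.
  by rewrite (le_trans (ler_normD _ _))// lerD.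
- move=> a u /bounded_seqP[B uB]; apply/bounded_seqP; exists (`|a| * B) => n.
  by rewrite normrM ler_wpM2l.
Qed.

HB.instance Definition _ :=
  GRing.isSubmodClosed.Build R (nat -> R) bounded_seq bounded_seq_submod.

Record linfty := Linfty {
  seq_of :> nat -> R;
  linftyP : seq_of \in bounded_seq }.

HB.instance Definition _ := [isSub for seq_of].
HB.instance Definition _ := [Choice of linfty by <:].
HB.instance Definition _ := [SubChoice_isSubLmodule of linfty by <:].

Definition linfty_norm (u : linfty) : R := sup (range (fun n => `|u n|)).

Let norm_has_sup (u : linfty) : has_sup (range (fun n => `|u n|)).
Proof.
split; first by exists `|u 0%N|, 0%N.
by have /bounded_seqP[B uB] := linftyP u; exists B => _ [n _ <-].
Qed.

Lemma linfty_norm_ub (u : linfty) n : `|u n| <= linfty_norm u.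
Proof. by apply: ub_le_sup; [case: (norm_has_sup u) | exists n]. Qed.

Lemma linfty_norm_le (u : linfty) B :
  (forall n, `|u n| <= B) -> linfty_norm u <= B.
Proof.
move=> uB; apply: ge_sup; first by case: (norm_has_sup u).
by move=> _ [n _ <-].
Qed.

Lemma linfty_normD (u v : linfty) :
  linfty_norm (u + v) <= linfty_norm u + linfty_norm v.
Proof.
apply: linfty_norm_le => n.
by rewrite (le_trans (ler_normD _ _))// lerD// linfty_norm_ub.
Qed.

Lemma linfty_normZ (a : R) (u : linfty) :
  linfty_norm (a *: u) = `|a| * linfty_norm u.
Proof.
apply/eqP; rewrite eq_le; apply/andP; split.
  by apply: linfty_norm_le => n; rewrite normrM ler_wpM2l// linfty_norm_ub.
have [->|a0] := eqVneq a 0.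
  by rewrite normr0 mul0r (le_trans _ (linfty_norm_ub _ 0%N)).
rewrite mulrC -ler_pdivlMr ?normr_gt0//; apply: linfty_norm_le => n.
rewrite ler_pdivlMr ?normr_gt0// mulrC -normrM.
exact: (linfty_norm_ub (a *: u)).
Qed.

Lemma linfty_norm0_eq0 (u : linfty) : linfty_norm u = 0 -> u = 0.
Proof.
move=> u0; apply/val_inj/funext => n; apply/normr0_eq0/eqP.
by rewrite eq_le normr_ge0 andbT -u0 linfty_norm_ub.
Qed.

HB.instance Definition _ := Lmodule_isNormed.Build R linfty
  linfty_normD linfty_normZ linfty_norm0_eq0.

End Linfty.

(* An isometric copy of R inside l^oo; it need not be a linear subspace. *)
Record real_copy (R : realType) := RealCopy {
  iota :> R -> linfty R;
  iota_isometry : forall r s, `|iota r - iota s| = `|r - s| }.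

(* A tuple of sorted variables, indexed by a finite type. *)
Record ctx (S : Type) := Ctx { idx :> finType; sort_of : idx -> S }.
Arguments sort_of {S} c i.

Definition ctx_join S (X Y : ctx S) : ctx S :=
  Ctx (fun i : (X + Y)%type =>
    match i with inl j => sort_of X j | inr j => sort_of Y j end).

(* The new variable is None. *)
Definition ctx_ext S (X : ctx S) (s : S) : ctx S :=
  Ctx (fun i : option X => if i is Some j then sort_of X j else s).

(* The distance symbol of a sort s is a predicate symbol whose value set is (the
   copy in l^oo of) dist_set s; the usual convention is the interval [0, 1].
   A modulus maps e > 0 to d > 0 such that tuples of arguments at distance < d
   for the maximum metric have values at distance <= e. *)
Record language (R : realType) := Language {
  lsort : Type;
  dist_set : lsort -> set R;
  fsym : Type;
  fdom : fsym -> ctx lsort;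
  fcod : fsym -> lsort;
  fmodulus : fsym -> R -> R;
  psym : Type;
  pdom : psym -> ctx lsort;
  pset : psym -> set (linfty R);
  pmodulus : psym -> R -> R;
  dist_set_compact : forall s, compact (dist_set s);
  dist_set_ge0 : forall s r, dist_set s r -> 0 <= r;
  pset_compact : forall P, compact (pset P);
  fmodulus_gt0 : forall f e, 0 < e -> 0 < fmodulus f e;
  pmodulus_gt0 : forall P e, 0 < e -> 0 < pmodulus P e }.

Definition env S (T : S -> Type) (X : ctx S) := forall i : X, T (sort_of X i).

Definition env_join S (T : S -> Type) (X Y : ctx S)
    (a : env T X) (b : env T Y) : env T (ctx_join X Y) :=
  fun i => match i with inl j => a j | inr j => b j end.

Definition env_ext S (T : S -> Type) (X : ctx S) (s : S)
    (a : env T X) (c : T s) : env T (ctx_ext X s) :=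
  fun i => match i with Some j => a j | None => c end.

Definition env_map S (T U : S -> Type) (h : forall s, T s -> U s) (X : ctx S)
    (a : env T X) : env U X := fun i => h (sort_of X i) (a i).

Record structure (R : realType) (L : language R) := Structure {
  carrier : lsort L -> metricType R;
  carrier_inhabited : forall s, inhabited (carrier s);
  carrier_complete : forall s (F : set_system (carrier s)),
    ProperFilter F -> cauchy F -> exists l : carrier s, F --> l;
  carrier_dist : forall s (a b : carrier s), dist_set s (mdist a b);
  fval : forall f : fsym L, env carrier (fdom f) -> carrier (fcod f);
  fval_unif : forall f e (a b : env carrier (fdom f)), 0 < e ->
    (forall i, mdist (a i) (b i) < fmodulus f e) ->
    mdist (fval a) (fval b) <= e;
  pval : forall P : psym L, env carrier (pdom P) -> linfty R;
  pval_pset : forall P (a : env carrier (pdom P)), pset P (pval a);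
  pval_unif : forall P e (a b : env carrier (pdom P)), 0 < e ->
    (forall i, mdist (a i) (b i) < pmodulus P e) ->
    `|pval a - pval b| <= e }.

Definition tuples (R : realType) (L : language R) (M : structure L)
  (X : ctx (lsort L)) := env (carrier M) X.

Section Syntax.
Variables (R : realType) (io : real_copy R) (L : language R).

Inductive term (X : ctx (lsort L)) : lsort L -> Type :=
| Var (i : X) : term X (sort_of X i)
| App (f : fsym L) (t : forall i : fdom f, term X (sort_of (fdom f) i)) :
    term X (fcod f).

(* The second argument is the value set K_phi of the formula. *)
Inductive formula (X : ctx (lsort L)) : set (linfty R) -> Type :=
| Dist s (t1 t2 : term X s) : formula X (io @` dist_set s)
| Pred (P : psym L) (t : forall i : pdom P, term X (sort_of (pdom P) i)) :
    formula X (pset P)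
| Conn n (u : 'rV[linfty R]_n -> linfty R) (K : 'I_n -> set (linfty R)) :
    continuous u -> (forall i, formula X (K i)) ->
    formula X (u @` [set v : 'rV[linfty R]_n | forall i, K i (v ord0 i)])
| Sup s K : K `<=` io @` [set r | 0 <= r] -> formula (ctx_ext X s) K ->
    formula X K
| Inf s K : K `<=` io @` [set r | 0 <= r] -> formula (ctx_ext X s) K ->
    formula X K.

Fixpoint term_eval (M : structure L) (X : ctx (lsort L)) (a : tuples M X)
    (s : lsort L) (t : term X s) : carrier M s :=
  match t with
  | Var i => a i
  | App f t => fval (fun i => term_eval a (t i))
  end.

Fixpoint formula_eval (M : structure L) (X : ctx (lsort L)) K
    (phi : formula X K) : tuples M X -> linfty R :=
  match phi with
  | Dist s t1 t2 => fun a => io (mdist (term_eval a t1) (term_eval a t2))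
  | Pred P t => fun a => pval (fun i => term_eval a (t i))
  | Conn n u K _ psi => fun a => u (\row_i formula_eval (psi i) a)
  | Sup s K _ psi => fun a =>
      io (sup (io @^-1`
        range (fun c : carrier M s => formula_eval psi (env_ext a c))))
  | Inf s K _ psi => fun a =>
      io (inf (io @^-1`
        range (fun c : carrier M s => formula_eval psi (env_ext a c))))
  end.

(* N is an elementary extension of M, up to the identification of M with its
   image: since the distance formulas are included, an elementary embedding is
   isometric and commutes with the function symbols. *)
Record elem_ext (M N : structure L) := ElemExt {
  emb :> forall s, carrier M s -> carrier N s;
  emb_eval : forall X K (phi : formula X K) (a : tuples M X),
    formula_eval phi (env_map emb a) = formula_eval phi a }.

Lemma comp_emb_eval (M N P : structure L) (g : elem_ext M N)
    (h : elem_ext N P) X K (phi : formula X K) (a : tuples M X) :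
  formula_eval phi (env_map (fun s (c : carrier M s) => h s (g s c)) a) =
  formula_eval phi a.
Proof. by rewrite -(emb_eval g) -(emb_eval h). Qed.

Definition elem_ext_comp (M N P : structure L) (g : elem_ext M N)
    (h : elem_ext N P) : elem_ext M P := ElemExt (comp_emb_eval g h).

Section Types.
Variables (X Y : ctx (lsort L)) (K : set (linfty R)).
Variable phi : formula (ctx_join X Y) K.

(* A complete phi-type p over N, given by the function b |-> phi(p, b) that it
   determines; p has a realization a in some elementary extension N' of N. *)
Record phi_type (N : structure L) := PhiType {
  type_val :> tuples N Y -> linfty R;
  type_realized :
    exists (N' : structure L) (h : elem_ext N N') (a : tuples N' X),
      forall b : tuples N Y,
        type_val b = formula_eval phi (env_join a (env_map h b)) }.

Definition extends (N0 N : structure L) (h : elem_ext N0 N)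
    (p : phi_type N0) (q : phi_type N) : Prop :=
  forall b : tuples N0 Y, q (env_map h b) = p b.

Definition finitely_satisfiable (M N : structure L) (h : elem_ext M N)
    (p : phi_type N) : Prop :=
  forall n (b : 'I_n -> tuples N Y) (delta : R), 0 < delta ->
    exists a : tuples M X, forall i,
      `|formula_eval phi (env_join (env_map h a) (b i)) - p (b i)| < delta.

End Types.

End Syntax.

(* Main.v *)
(* Finite satisfiability says that the sets {a | |phi(a, b) - p(b)| < d} have
   the finite intersection property in M^x; let U be an ultrafilter containing
   them. In the metric ultrapower of N along U, the class of the identity family
   realizes over N the type q(b) = lim_U phi(a, b), by Los's theorem. It extends
   p by the choice of U, and it is finitely satisfiable in M because U lives on
   M^x.
   The ultrapower is complete for an arbitrary, possibly countably complete, U: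
   the limit of a fast Cauchy sequence of classes is formed coordinatewise,
   either from an initial fast segment or using completeness of N. *)
Require Import Defs.
From HB Require Import structures.
From mathcomp Require Import all_boot all_order all_algebra.
From mathcomp Require Import generic_quotient.
From mathcomp Require Import all_classical all_reals all_analysis.
From mathcomp Require Import lra.

Set Implicit Arguments.
Unset Strict Implicit.
Unset Printing Implicit Defensive.

Import Order.TTheory GRing.Theory Num.Theory.
Import numFieldNormedType.Exports.
(* MathComp-Analysis also defines fsym and pset. *)
Import Defs.

Local Open Scope classical_set_scope.
Local Open Scope ring_scope.
Local Open Scope quotient_scope.

(** * Limits along filters and ultrafilters *)

Lemma ultra_cvg (I : Type) (U : set_system I) (V : topologicalType)
    (K : set V) (x : I -> V) :
  UltraFilter U -> compact K -> (forall i, K (x i)) ->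
  exists2 l, K l & x @ U --> l.
Proof.
move=> UU cK Kx.
have [|l [Kl xl]] := cK (x @ U) _.
  rewrite fmapE; exact: (@filterE _ U _ _ Kx).
exists l => // A nA.
(* If the preimage of a neighbourhood [A] of the cluster point [l] were not in [U], its complement
   would be, and clustering at [l] would yield a point both in [A] and outside it. *)
have [//|UA] := in_ultra_setVsetC (x @^-1` A) UU.
by have [y [/= nAy Ay]] := xl (~` A) A UA nA.
Qed.

Lemma le_cvg_along (T : Type) (F : set_system T) (FF : ProperFilter F)
    (R : realType) (f g : T -> R) (l m : R) :
  f @ F --> l -> g @ F --> m -> (\forall t \near F, f t <= g t) -> l <= m.
Proof.
move=> fl gm fg; have gfml : g t - f t @[t --> F] --> m - l by exact: cvgB.
rewrite -subr_ge0 -(cvg_lim (@Rhausdorff R) gfml); apply: limr_ge.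
  by apply/cvg_ex; eexists; exact: gfml.
by near=> t; rewrite /= subr_ge0; near: t.
Unshelve. all: by end_near. Qed.

(** * The metric ultrapower of a single sort *)

Section UltraDistance.
Variables (R : realType) (I : Type) (U : set_system I).
Hypothesis UU : UltraFilter U.
Variables (T : metricType R) (D : set R).
Hypotheses (cD : compact D) (TD : forall a b : T, D (mdist a b)).

(** The limit exists for all families because distances lie in the compact set [D]. This is a
    pseudometric on [I -> T], and the ultrapower is its metric quotient. *)
Definition ultra_dist (f g : I -> T) : R := lim (mdist (f i) (g i) @[i --> U]).

Lemma ultra_dist_cvg f g : mdist (f i) (g i) @[i --> U] --> ultra_dist f g.
Proof.
have [l _ fgl] := ultra_cvg UU cD (fun i => TD (f i) (g i)).
by apply/cvg_ex; exists l.
Qed.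

Lemma ultra_dist_in f g : D (ultra_dist f g).
Proof.
have cvg_fg := @ultra_dist_cvg f g.
apply: (@closed_cvg _ _ U _ _ D _ _ _ cvg_fg).
  exact: (compact_closed _ cD).
by apply: nearW => i; exact: TD.
Qed.

Lemma ultra_dist_unique f g l :
  mdist (f i) (g i) @[i --> U] --> l -> ultra_dist f g = l.
Proof. by apply: cvg_lim. Qed.

Lemma ultra_distxx f : ultra_dist f f = 0.
Proof.
apply: ultra_dist_unique; under eq_fun do rewrite mdistxx.
exact: cvg_cst.
Qed.

Lemma ultra_distC f g : ultra_dist f g = ultra_dist g f.
Proof.
apply: ultra_dist_unique; under eq_fun do rewrite metric_sym.
exact: ultra_dist_cvg.
Qed.

Lemma ultra_distD g f k : ultra_dist f k <= ultra_dist f g + ultra_dist g k.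
Proof.
have fgk : mdist (f i) (g i) + mdist (g i) (k i) @[i --> U] -->
    ultra_dist f g + ultra_dist g k.
  by apply: cvgD; exact: ultra_dist_cvg.
apply: (le_cvg_along _ (@ultra_dist_cvg f k) fgk).
by apply: nearW => i; exact: metric_triangle.
Qed.

Lemma ultra_dist_ge0 f g : 0 <= ultra_dist f g.
Proof.
apply: limr_ge; first by apply/cvg_ex; eexists; exact: ultra_dist_cvg.
by apply: nearW => i; exact: mdist_ge0.
Qed.

Definition ultra_eq : rel (I -> T) := fun f g => ultra_dist f g == 0.

Lemma ultra_eq_refl : reflexive ultra_eq.
Proof. by move=> f; rewrite /ultra_eq ultra_distxx. Qed.

Lemma ultra_eq_sym : symmetric ultra_eq.
Proof. by move=> f g; rewrite /ultra_eq ultra_distC. Qed.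

Lemma ultra_eq_trans : transitive ultra_eq.
Proof.
move=> g f k /eqP fg /eqP gk; rewrite /ultra_eq eq_le ultra_dist_ge0 andbT.
by rewrite (le_trans (ultra_distD g f k))// fg gk addr0.
Qed.

Canonical ultra_equiv := EquivRel ultra_eq ultra_eq_refl ultra_eq_sym
  ultra_eq_trans.

Definition ultrapower : Type := {eq_quot ultra_equiv}.
HB.instance Definition _ := Choice.on ultrapower.

Definition ultra_class (f : I -> T) : ultrapower := \pi_{eq_quot ultra_equiv} f.
Definition ultra_repr (a : ultrapower) : I -> T :=
  repr (a : {eq_quot ultra_equiv}).

Lemma ultra_reprK a : ultra_class (ultra_repr a) = a.
Proof. exact: reprK. Qed.

Lemma ultra_classP f g : ultra_dist f g = 0 <-> ultra_class f = ultra_class g.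
Proof. by split=> [/eqP fg|/eqmodP/eqP//]; apply/eqmodP. Qed.

Definition ultrapower_dist a b := ultra_dist (ultra_repr a) (ultra_repr b).

Let dist_pos a b : ultrapower_dist a b = 0 -> a = b.
Proof. by move/ultra_classP; rewrite !ultra_reprK. Qed.

HB.instance Definition _ := @isMetric.Build R ultrapower ultrapower_dist
  (fun a => ultra_distxx _) dist_pos (fun a b => ultra_distC _ _)
  (fun b a c => ultra_distD _ _ _).

(** The chosen representative of the class of [k] is at ultra-distance 0 from [k], so two triangle
    inequalities give each direction. *)
Lemma mdist_ultra_class f g :
  mdist (ultra_class f) (ultra_class g) = ultra_dist f g.
Proof.
have repr0 k : ultra_dist (ultra_repr (ultra_class k)) k = 0.
  by apply/ultra_classP; rewrite ultra_reprK.
rewrite [LHS]/(ultra_dist _ _); apply/eqP; rewrite eq_le; apply/andP; split.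
  apply: (le_trans (ultra_distD f _ _)); rewrite repr0 add0r.
  apply: (le_trans (ultra_distD g _ _)).
  by rewrite (ultra_distC g) repr0 addr0.
set f' := ultra_repr (ultra_class f); set g' := ultra_repr (ultra_class g).
apply: (le_trans (ultra_distD f' _ _)); rewrite ultra_distC repr0 add0r.
by apply: (le_trans (ultra_distD g' _ _)); rewrite repr0 addr0.
Qed.

Lemma cvg_mdist_ultra_class f g :
  mdist (f i) (g i) @[i --> U] --> mdist (ultra_class f) (ultra_class g).
Proof. by rewrite mdist_ultra_class; exact: ultra_dist_cvg. Qed.

Lemma cvg_mdist_ultra_repr a b :
  mdist (ultra_repr a i) (ultra_repr b i) @[i --> U] --> mdist a b.
Proof.
rewrite -{2}[a]ultra_reprK -{2}[b]ultra_reprK.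
exact: cvg_mdist_ultra_class.
Qed.

End UltraDistance.

Arguments ultra_class {R I U} UU {T D} cD TD f.
Arguments cvg_mdist_ultra_class {R I U} UU {T D} cD TD f g.
Arguments cvg_mdist_ultra_repr {R I U UU T D cD TD} a b.

(** * Completeness of the metric ultrapower *)

Section FastCauchy.
Variables (R : realType) (T : metricType R).
Hypothesis T_complete : forall F : set_system T,
  ProperFilter F -> cauchy F -> exists l : T, F --> l.

Let e n : R := 2^-1 ^+ n.

Let e_gt0 n : 0 < e n. Proof. by rewrite exprn_gt0// invr_gt0. Qed.

Let eS n : e n.+1 = e n / 2. Proof. by rewrite /e exprSr. Qed.

Lemma exp2V_lt (eps : R) : 0 < eps -> exists n, 2^-1 ^+ n < eps.
Proof.
move=> eps0; have half_lt1 : `|2^-1 : R| < 1 by rewrite ger0_norm; lra.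
near \oo => n; exists n; rewrite (le_lt_trans (ler_norm _))//; near: n.
exact: cvgr0_norm_lt (cvg_expr half_lt1) _ eps0.
Unshelve. all: by end_near. Qed.

Let fast (f : nat -> T) n := forall k, (k < n)%N -> mdist (f k) (f k.+1) < e k.

Let fast_dist f m n : fast f m -> (n <= m)%N ->
  mdist (f n) (f m) <= 2 * e n.
Proof.
(* The stronger bound is the geometric sum of [e k] over [n <= k < m], which telescopes in the
   induction on [m]. *)
move=> fm nm; suff : mdist (f n) (f m) <= 2 * e n - 2 * e m.
  by move/le_trans; apply; rewrite gerBl mulr_ge0// ltW ?e_gt0.
elim: m nm fm => [|m ih].
  by rewrite leqn0 => /eqP-> _; rewrite mdistxx subrr.
rewrite leq_eqVlt => /predU1P[-> _|]; first by rewrite mdistxx subrr.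
rewrite ltnS => nm fm.
have {}ih := ih nm (fun k km => fm k (ltnW km)).
have := fm m (ltnSn m); have := metric_triangle (f n) (f m) (f m.+1).
rewrite eS; lra.
Qed.

(* If only an initial segment of [f] is fast, its last term serves as limit. *)
Lemma fast_limit (f : nat -> T) : exists t, forall n,
  (forall k, (k < n)%N -> mdist (f k) (f k.+1) < 2^-1 ^+ k) ->
  mdist (f n) t <= 2 * 2^-1 ^+ n.
Proof.
have [allf|notallf] := pselect (forall n, fast f n); last first.
  have exf : exists n, `[< ~ fast f n >].
    by case/existsNP: notallf => n fn; exists n; apply/asboolP.
  (* Here [k.+1] is the least length at which speed fails: [f] is fast up to [k], and every [n] up
     to which it is fast satisfies [n <= k]. *)
  case: (ex_minnP exf) => -[|k] /asboolP fNk kmin; first by case: fNk.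
  exists (f k) => n fn; have nk : (n <= k)%N.
    rewrite leqNgt; apply/negP => kn; apply: fNk => j jk.
    by apply: fn; rewrite (leq_trans jk).
  apply: fast_dist nk; have [//|fk] := pselect (fast f k).
  by have := kmin k; rewrite ltnn => /(_ (asboolT fk)).
have fdist m n : (n <= m)%N -> mdist (f n) (f m) <= 2 * e n.
  exact: fast_dist (allf m).
have [|t ft] := @T_complete (f @ \oo) _.
  apply/cauchy_exP => _ /posnumP[eps].
  have [//|n en] := @exp2V_lt (eps%:num / 2); exists (f n).
  exists n => // m /= nm; rewrite ballEmdist/=.
  by rewrite (le_lt_trans (fdist _ _ nm))// mulrC -ltr_pdivlMr.
exists t => n _; apply/ler_addgt0Pr => eps eps0.
near \oo => m.
rewrite (le_trans (metric_triangle _ (f m) _))// lerD//.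
  by apply: fdist; near: m; exists n.
rewrite metric_sym ltW//; near: m.
exact: metricType_numDomainType.cvgr_dist_lt ft _ eps0.
Unshelve. all: by end_near. Qed.

End FastCauchy.

Section UltraComplete.
Variables (R : realType) (I : Type) (U : set_system I).
Hypothesis UU : UltraFilter U.
Variables (T : metricType R) (D : set R).
Hypotheses (cD : compact D) (TD : forall a b : T, D (mdist a b)).
Hypothesis T_complete : forall F : set_system T,
  ProperFilter F -> cauchy F -> exists l : T, F --> l.

(** Centres of shrinking balls in [F] form a fast sequence of classes. Their representatives at one
    index may be fast only for a while, and [fast_limit] still supplies a point there; the class of
    these points is the limit. *)
Lemma ultrapower_complete (F : set_system (ultrapower UU cD TD)) :
  ProperFilter F -> cauchy F -> exists l : ultrapower UU cD TD, F --> l.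
Proof.
move=> PF /cauchyP Fc.
have e0 n : 0 < 2^-1 ^+ n.+1 :> R by rewrite exprn_gt0// invr_gt0.
have [a Fa] := choice (fun n => Fc _ (e0 n)).
(* Both balls belong to the proper filter [F], hence meet, and their radii add up to three quarters
   of [2^-1 ^+ n]. *)
have aa n : mdist (a n) (a n.+1) < 2^-1 ^+ n.
  have [b [an anS]] : (ball (a n) (2^-1 ^+ n.+1) `&`
      ball (a n.+1) (2^-1 ^+ n.+2)) !=set0.
    by exact: filter_ex (filterI (Fa n) (Fa n.+1)).
  move: an anS; rewrite !ballEmdist/= => an anS.
  have := metric_triangle (a n) b (a n.+1); rewrite (metric_sym b).
  by move: an anS (e0 n); rewrite (exprSr _ n.+1) (exprSr _ n); lra.
pose f n := ultra_repr (a n).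
have [g fg] := choice (fun i => fast_limit T_complete (fun n => f n i)).
exists (ultra_class UU cD TD g).
apply/metricType_numDomainType.fcvgrPdist_lt => eps eps0.
(* The final distance is at most [2 * 2^-1 ^+ n] from the limit to [a n] plus [2^-1 ^+ n.+1] from
   [a n] to a point of its ball, in total below four times [2^-1 ^+ n]. *)
have [|n en] := @exp2V_lt R (eps / 4); first lra.
have ag : mdist (a n) (ultra_class UU cD TD g) <= 2 * 2^-1 ^+ n.
  (* Only the first [n] steps enter, so finitely many sets of [U] are intersected. *)
  have fast_near : \forall i \near U,
      forall k, (k < n)%N -> mdist (f k i) (f k.+1 i) < 2^-1 ^+ k.
    have : \forall i \near U, forall k : 'I_n,
        mdist (f k i) (f k.+1 i) < 2^-1 ^+ k.
      apply: filter_forall => k.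
      exact: (cvgr_lt _ (cvg_mdist_ultra_repr (a k) (a k.+1)) _ (aa k)).
    by apply: filterS => i fi k kn; exact: (fi (Ordinal kn)).
  rewrite -[a n]ultra_reprK.
  apply: (le_cvg_along _ (cvg_mdist_ultra_class UU cD TD _ _) (cvg_cst _)).
  by apply: filterS fast_near => i; exact: fg.
apply: filterS (Fa n) => b; rewrite ballEmdist/= => ab.
have := metric_triangle (ultra_class UU cD TD g) (a n) b.
rewrite (metric_sym _ (a n)).
by move: ag ab en (e0 n); rewrite exprSr; lra.
Qed.

End UltraComplete.

(** * Suprema and infima along a filter, for the quantifier cases *)

Lemma sup_cvg_along (R : realType) (I C C' : Type) (U : set_system I)
    (FU : ProperFilter U) (cls : (I -> C) -> C') (r : I -> C -> R)
    (r' : C' -> R) (B : R) :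
  inhabited C -> (forall c', exists c, cls c = c') ->
  (forall i c, r i c <= B) -> (forall c, r' c <= B) ->
  (forall c, r i (c i) @[i --> U] --> r' (cls c)) ->
  sup (range (r i)) @[i --> U] --> sup (range r').
Proof.
move=> [c0] cls_surj rB r'B rr'.
have sr i : has_sup (range (r i)).
  by split; [exists (r i c0), c0|exists B => _ [c _ <-]].
have sr' : has_sup (range r').
  by split; [exists (r' (cls (fun=> c0))), (cls (fun=> c0))|
             exists B => _ [c _ <-]].
apply/cvgrPdist_lt => e e0; have e20 : 0 < e / 2 by rewrite divr_gt0.
(* Lower bound: an almost optimal [c'] lifts to a family [c], whose values bound the suprema at
   nearby indices from below. *)
have [_ [c' _ <-] supc'] := sup_adherent e0 sr'.
have [c cc'] := cls_surj c'.
(* Upper bound: almost optimal choices at all indices form one family [d], and the value of [r'] at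
   its class is at most the limiting supremum. *)
have d_ex i : exists d, sup (range (r i)) - e / 2 < r i d.
  by have [_ [d _ <-] supd] := sup_adherent e20 (sr i); exists d.
have [d supd] := choice d_ex.
have sup_d : r' (cls d) < sup (range r') + e / 2.
  rewrite (@le_lt_trans _ _ (sup (range r')))//; last by rewrite ltrDl.
  by apply: ub_le_sup; [case: sr' | exists (cls d)].
rewrite -cc' in supc'.
have near_d := cvgr_lt _ (rr' d) _ sup_d.
have near_c := cvgr_gt _ (rr' c) _ supc'.
near=> i.
have rc : r i (c i) <= sup (range (r i)).
  by apply: ub_le_sup; [case: (sr i) | exists (c i)].
have : sup (range r') - e < r i (c i) by near: i; exact: near_c.
have : r i (d i) < sup (range r') + e / 2 by near: i; exact: near_d.
have := supd i; rewrite ltr_norml; lra.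
Unshelve. all: by end_near. Qed.

Lemma inf_range_opp (R : realType) (C : Type) (r : C -> R) :
  inf (range r) = - sup (range (\- r)).
Proof. by rewrite /inf image_comp. Qed.

Lemma inf_cvg_along (R : realType) (I C C' : Type) (U : set_system I)
    (FU : ProperFilter U) (cls : (I -> C) -> C') (r : I -> C -> R)
    (r' : C' -> R) (B : R) :
  inhabited C -> (forall c', exists c, cls c = c') ->
  (forall i c, B <= r i c) -> (forall c, B <= r' c) ->
  (forall c, r i (c i) @[i --> U] --> r' (cls c)) ->
  inf (range (r i)) @[i --> U] --> inf (range r').
Proof.
move=> C0 cls_surj rB r'B rr'; rewrite inf_range_opp.
under eq_fun do rewrite inf_range_opp.
apply: cvgN; apply: (@sup_cvg_along R I C C' U FU cls
  (fun i => \- r i) (\- r') (- B)) => //= [i c|c|c].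
- by rewrite lerN2.
- by rewrite lerN2.
- exact: cvgN.
Qed.

(** * The copy of the reals and the value sets of formulas *)

Section RealCopy.
Variables (R : realType) (io : real_copy R).

Lemma iota_inj : injective io.
Proof.
move=> r s rs; apply/eqP; rewrite -subr_eq0 -normr_eq0 -(iota_isometry io).
by rewrite rs subrr normr0.
Qed.

Lemma iota_cvg (I : Type) (F : set_system I) (FF : Filter F) (r : I -> R) l :
  io (r i) @[i --> F] --> io l <-> r @ F --> l.
Proof.
split=> /cvgrPdist_lt rl; apply/cvgrPdist_lt => e e0;
  by move: (rl e e0); apply: filterS => i; rewrite iota_isometry.
Qed.

Lemma iota_continuous : continuous io.
Proof. by move=> r; apply/iota_cvg; exact: cvg_id. Qed.

Variable K : set (linfty R).
Hypotheses (cK : compact K) (K_ge0 : K `<=` io @` [set r | 0 <= r]).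

(** Applied with [f] the identity for suprema and with negation for infima. *)
Let closed_preK (f : R -> R) : continuous f -> closed ((io \o f) @^-1` K).
Proof.
move=> fc; apply: closed_comp; last first.
  exact: compact_closed (@norm_hausdorff _ _) cK.
by move=> x _; apply: continuous_comp; [exact: fc|exact: iota_continuous].
Qed.

Lemma value_bound : exists B, forall r, K (io r) -> 0 <= r <= B.
Proof.
have [B [_ KB]] := compact_bounded cK.
(* Norms in [K] are bounded by any number above [B], hence [B + 1]. The term [|io 0|] appears
   because [r] is measured by the distance from [io r] to [io 0], and the copy may move the
   origin. *)
exists (B + 1 + `|io 0|) => r Kr; apply/andP; split.
  by have [s /= s0 /iota_inj <-] := K_ge0 Kr.
have /KB/(_ _ Kr)/= Br : B < B + 1 by rewrite ltrDl.
rewrite (le_trans (ler_norm _))// -[r]subr0 -(iota_isometry io).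
by rewrite (le_trans (ler_normB _ _))// lerD2r.
Qed.

(** This identifies the preimages under [io] in the quantifier clauses of [formula_eval] with ranges
    of real functions. Their bounds stay in [K] because they are limits of values and [K] is
    closed. *)
Lemma iota_values (C : Type) (F : C -> linfty R) : inhabited C ->
    (forall c, K (F c)) ->
  exists r : C -> R, [/\ F = io \o r, io @^-1` range F = range r,
    K (io (sup (range r))) & K (io (inf (range r)))].
Proof.
move=> C0 KF; have [B KB] := value_bound.
have /choice[r Fr] c : exists r, F c = io r.
  by have [r _ <-] := K_ge0 (KF c); exists r.
have Kr c : K (io (r c)) by rewrite -Fr.
exists r; split.
- exact/funext.
- apply/seteqP; split=> [s [c _]|_ [c _ <-]]; last by exists c.
  by rewrite Fr => /iota_inj <-; exists c.
- have cl : closure (range r) (sup (range r)).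
    apply: closure_sup; first by case: C0 => c; exists (r c), c.
    by exists B => _ [c _ <-]; case/andP: (KB _ (Kr c)).
  have rK : range r `<=` (io \o id) @^-1` K by move=> _ [c _ <-]; exact: Kr.
  apply: (@closed_preK id); first by move=> x; exact: cvg_id.
  exact: (closureS rK cl).
- have cl : closure (range (\- r)) (sup (range (\- r))).
    apply: closure_sup; first by case: C0 => c; exists (- r c), c.
    by exists 0 => _ [c _ <-]; case/andP: (KB _ (Kr c)); rewrite /= oppr_le0.
  have rK : range (\- r) `<=` (io \o -%R) @^-1` K.
    by move=> _ [c _ <-]; rewrite /= opprK; exact: Kr.
  rewrite inf_range_opp; apply: (@closed_preK -%R); first exact: opp_continuous.
  exact: (closureS rK cl).
Qed.

End RealCopy.

Section Values.
Variables (R : realType) (io : real_copy R) (L : language R).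

Lemma formula_compact (X : ctx (lsort L)) K (phi : formula io X K) : compact K.
Proof.
elim: phi => {X K} [X s _ _|X P _|X n u K uc _ cK|//|//].
- apply: continuous_compact (@dist_set_compact _ L s).
  exact/continuous_subspaceT/iota_continuous.
- exact: pset_compact.
- apply: continuous_compact (rV_compact cK).
  exact: continuous_subspaceT.
Qed.

Variable M : structure L.

Lemma formula_evalP (X : ctx (lsort L)) K (phi : formula io X K)
  (a : tuples M X) : K (formula_eval phi a).
Proof.
elim: phi a => {X K} [X s t1 t2|X P t|X n u K uc psi ih|X s K K0 psi ih
  |X s K K0 psi ih] a /=.
- exists (mdist (term_eval a t1) (term_eval a t2)) => //.
  exact: carrier_dist.
- exact: pval_pset.
- by exists (\row_i formula_eval (psi i) a) => // i; rewrite mxE; exact: ih.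
- have [r [_ -> Ksup _]] := iota_values (formula_compact psi) K0
    (carrier_inhabited M s) (fun c => ih (env_ext a c)).
  exact: Ksup.
- have [r [_ -> _ Kinf]] := iota_values (formula_compact psi) K0
    (carrier_inhabited M s) (fun c => ih (env_ext a c)).
  exact: Kinf.
Qed.

End Values.

Lemma cvg_row (I : Type) (F : set_system I) (FF : Filter F)
    (T : topologicalType) n (v : 'I_n -> I -> T) (l : 'I_n -> T) :
  (forall j, v j i @[i --> F] --> l j) ->
  \row_j v j i @[i --> F] --> \row_j l j.
Proof.
move=> vl A [B lB BA]; rewrite /= nbhs_filterE.
have : \forall i \near F, forall j, B ord0 j (v j i).
  by apply: filter_forall => j; apply: vl; have := lB ord0 j; rewrite mxE.
by apply: filterS => i vB; apply: BA => i0 j; rewrite ord1 mxE; exact: vB.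
Qed.

(** * The ultrapower structure and Los's theorem *)

Section UltraStructure.
Variables (R : realType) (L : language R) (N : structure L).
Variables (I : Type) (U : set_system I).
Hypothesis UU : UltraFilter U.

Definition ultra_carrier (s : lsort L) : metricType R :=
  ultrapower UU (@dist_set_compact _ L s) (@carrier_dist _ _ N s).

Definition ucls s (k : I -> carrier N s) : ultra_carrier s :=
  ultra_class UU (@dist_set_compact _ L s) (@carrier_dist _ _ N s) k.

Definition urepr s (a : ultra_carrier s) : I -> carrier N s := ultra_repr a.

Lemma ureprK s (a : ultra_carrier s) : ucls (urepr a) = a.
Proof. exact: ultra_reprK. Qed.

Lemma ucls_surj s (a : ultra_carrier s) : exists k, ucls k = a.
Proof. by exists (urepr a); exact: ureprK. Qed.

(** Representatives for tuples of the ultrapower, with one family per variable, so that classes are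
    taken variable by variable. *)
Definition powers (X : ctx (lsort L)) := env (fun s => I -> carrier N s) X.

Definition at_index X (f : powers X) (i : I) : tuples N X :=
  env_map (fun s (k : I -> carrier N s) => k i) f.

Definition env_cls X (f : powers X) : env ultra_carrier X := env_map ucls f.

Definition env_repr X (a : env ultra_carrier X) : powers X :=
  env_map urepr a.

Lemma env_reprK X (a : env ultra_carrier X) : env_cls (env_repr a) = a.
Proof. by apply: functional_extensionality_dep => j; exact: ureprK. Qed.

(** A context has finitely many variables, so the sets of [U] obtained for each of them can be
    intersected. *)
Lemma near_close X (f g : powers X) (d : R) :
  (forall j, mdist (env_cls f j) (env_cls g j) < d) ->
  \forall i \near U, forall j, mdist (at_index f i j) (at_index g i j) < d.
Proof.
move=> fgd; apply: filter_forall => j.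
exact: (cvgr_lt _ (cvg_mdist_ultra_class UU _ _ (f j) (g j)) _ (fgd j)).
Qed.

(** Computed on chosen representatives; [ultra_fval_cls] shows that the choice does not matter. *)
Definition ultra_fval (f : fsym L) (a : env ultra_carrier (fdom f)) :
    ultra_carrier (fcod f) :=
  ucls (fun i => fval (at_index (env_repr a) i)).

(** The modulus condition survives the limit: its strict premise holds at [U]-almost all indices,
    and its weak conclusion is closed. *)
Lemma fval_cls_close f (k l : powers (fdom f)) e : 0 < e ->
  (forall j, mdist (env_cls k j) (env_cls l j) < fmodulus f e) ->
  mdist (ucls (fun i => fval (at_index k i)))
        (ucls (fun i => fval (at_index l i))) <= e.
Proof.
move=> e0 kl.
apply: (le_cvg_along _ (cvg_mdist_ultra_class UU _ _ _ _) (cvg_cst _)).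
by apply: filterS (near_close kl) => i; exact: fval_unif.
Qed.

Lemma ultra_fval_unif f e (a b : env ultra_carrier (fdom f)) : 0 < e ->
  (forall j, mdist (a j) (b j) < fmodulus f e) ->
  mdist (ultra_fval a) (ultra_fval b) <= e.
Proof.
by move=> e0 ab; apply: fval_cls_close => // j; rewrite !env_reprK.
Qed.

(** Representatives of the same classes are at distance 0, below every modulus, so the two values
    are within every positive [e]. *)
Lemma ultra_fval_cls f (k : powers (fdom f)) :
  ultra_fval (env_cls k) = ucls (fun i => fval (at_index k i)).
Proof.
apply/mdist_positivity/eqP; rewrite eq_le mdist_ge0 andbT.
apply/ler_addgt0Pr => e e0; rewrite add0r; apply: fval_cls_close => // j.
by rewrite env_reprK mdistxx fmodulus_gt0.
Qed.

Lemma pval_ultra_cvg (P : psym L) (k : powers (pdom P)) :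
  exists2 l, pset P l & pval (at_index k i) @[i --> U] --> l.
Proof.
by apply: (ultra_cvg UU (@pset_compact _ L P)) => i; exact: pval_pset.
Qed.

Definition ultra_pval (P : psym L) (a : env ultra_carrier (pdom P)) :
    linfty R :=
  lim (pval (at_index (env_repr a) i) @[i --> U]).

Lemma ultra_pval_cvg P (a : env ultra_carrier (pdom P)) :
  pval (at_index (env_repr a) i) @[i --> U] --> ultra_pval a.
Proof.
by have [l _ kl] := pval_ultra_cvg (env_repr a); apply/cvg_ex; exists l.
Qed.

Lemma ultra_pval_pset P (a : env ultra_carrier (pdom P)) :
  pset P (ultra_pval a).
Proof.
have [l Pl kl] := pval_ultra_cvg (env_repr a).
by rewrite /ultra_pval (cvg_lim _ kl)//; exact: norm_hausdorff.
Qed.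

Lemma pval_close P (k l : powers (pdom P)) e : 0 < e ->
  (forall j, mdist (env_cls k j) (env_cls l j) < pmodulus P e) ->
  \forall i \near U, `|pval (at_index k i) - pval (at_index l i)| <= e.
Proof.
by move=> e0 kl; apply: filterS (near_close kl) => i; exact: pval_unif.
Qed.

Lemma ultra_pval_unif P e (a b : env ultra_carrier (pdom P)) : 0 < e ->
  (forall j, mdist (a j) (b j) < pmodulus P e) ->
  `|ultra_pval a - ultra_pval b| <= e.
Proof.
move=> e0 ab.
have cvg_ab : `|pval (at_index (env_repr a) i) - pval (at_index (env_repr b) i)|
    @[i --> U] --> `|ultra_pval a - ultra_pval b|.
  by apply: cvg_norm; apply: cvgB; exact: ultra_pval_cvg.
apply: (le_cvg_along _ cvg_ab (cvg_cst _)).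
by apply: pval_close => // j; rewrite !env_reprK.
Qed.

(** Independence of representatives again: [k] and the chosen representatives have values within
    [e / 2] at [U]-almost all indices, and the latter converge by definition. *)
Lemma ultra_pval_cls P (k : powers (pdom P)) :
  pval (at_index k i) @[i --> U] --> ultra_pval (env_cls k).
Proof.
apply/cvgrPdist_le => e e0; have e20 : 0 < e / 2 by rewrite divr_gt0.
have close := @pval_close P (env_repr (env_cls k)) k (e / 2) e20.
near=> i.
rewrite -(subrK (pval (at_index (env_repr (env_cls k)) i)) (ultra_pval _)).
rewrite -addrA (le_trans (ler_normD _ _))// [leRHS]splitr lerD//.
  by near: i; exact: cvgr_dist_le (ultra_pval_cvg (a := _)) _ e20.
near: i; apply: close => j.
by rewrite env_reprK mdistxx pmodulus_gt0.
Unshelve. all: by end_near. Qed.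

Let ultra_inhabited s : inhabited (ultra_carrier s).
Proof. by have [c] := carrier_inhabited N s; exists; exact: ucls (fun=> c). Qed.

Let ultra_complete s (F : set_system (ultra_carrier s)) :
  ProperFilter F -> cauchy F -> exists l : ultra_carrier s, F --> l.
Proof. by apply: ultrapower_complete; exact: carrier_complete. Qed.

Let ultra_carrier_dist s (a b : ultra_carrier s) : dist_set s (mdist a b).
Proof.
exact: (ultra_dist_in UU (@dist_set_compact _ L s) (@carrier_dist _ _ N s)).
Qed.

Definition ultra_structure : structure L := Structure ultra_inhabited
  ultra_complete ultra_carrier_dist ultra_fval_unif ultra_pval_pset
  ultra_pval_unif.

Variable io : real_copy R.

Lemma term_eval_ultra X s (t : term X s) (f : powers X) :
  @term_eval R L ultra_structure X (env_cls f) s t =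
  ucls (fun i => term_eval (at_index f i) t).
Proof.
elim: t => //= g t ih; rewrite -ultra_fval_cls; congr ultra_fval.
exact: functional_extensionality_dep.
Qed.

Lemma at_index_ext X s (f : powers X) (k : I -> carrier N s) i :
  at_index (env_ext f k : powers (ctx_ext X s)) i =
  env_ext (at_index f i) (k i).
Proof. by apply: functional_extensionality_dep => -[]. Qed.

Lemma env_cls_ext X s (f : powers X) (k : I -> carrier N s) :
  env_cls (env_ext f k : powers (ctx_ext X s)) = env_ext (env_cls f) (ucls k).
Proof. by apply: functional_extensionality_dep => -[]. Qed.

Let eval_ultra X K (phi : formula io X K) (a : env ultra_carrier X) :=
  @formula_eval R io L ultra_structure X K phi a.

(** Prepares [sup_cvg_along] and [inf_cvg_along]. The common bound comes from the value set [K],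
    shared by [N] and the ultrapower, and the convergence is the induction hypothesis for [f]
    extended by [k]. *)
Lemma los_quantifier X s K (psi : formula io (ctx_ext X s) K) (f : powers X) :
    K `<=` io @` [set r | 0 <= r] ->
    (forall k : powers (ctx_ext X s),
      formula_eval psi (at_index k i) @[i --> U] -->
      eval_ultra psi (env_cls k)) ->
  exists B (r : I -> carrier N s -> R) (r' : ultra_carrier s -> R),
  [/\ forall i, io @^-1`
        range (fun c => formula_eval psi (env_ext (at_index f i) c)) =
        range (r i),
      io @^-1` range (fun c => eval_ultra psi (env_ext (env_cls f) c)) =
        range r',
      forall i c, 0 <= r i c <= B, forall c, 0 <= r' c <= B
    & forall k, r i (k i) @[i --> U] --> r' (ucls k)].
Proof.
move=> K0 ih; have cK := formula_compact psi; have [B KB] := value_bound cK K0.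
have Nval i := iota_values cK K0 (carrier_inhabited N s)
  (fun c => formula_evalP psi (env_ext (at_index f i) c)).
have [r Nr] := choice Nval.
have uval c := @formula_evalP _ _ _ ultra_structure _ _ psi
  (env_ext (env_cls f) c).
have [r' [r'E r'R _ _]] := iota_values cK K0 (ultra_inhabited s) uval.
have rE i c : formula_eval psi (env_ext (at_index f i) c) = io (r i c).
  by have [/(congr1 (@^~ c))] := Nr i.
have {}r'E c : eval_ultra psi (env_ext (env_cls f) c) = io (r' c).
  by have /(congr1 (@^~ c)) := r'E.
exists B, r, r'; split => [i||i c|c|k].
- by have [] := Nr i.
- exact: r'R.
- by apply: KB; rewrite -rE; exact: formula_evalP.
- by apply: KB; rewrite -r'E; exact: formula_evalP.
- apply/(@iota_cvg _ io); rewrite -r'E -env_cls_ext.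
  rewrite (_ : (fun i => _) = fun i => formula_eval psi
    (at_index (env_ext f k : powers (ctx_ext X s)) i)); first exact: ih.
  by apply/funext => i; rewrite -rE -at_index_ext.
Qed.

(** Induction on [phi]: atomic values converge by construction of the ultrapower, connectives by
    continuity, and quantifiers by choosing almost optimal witnesses index by index. *)
Lemma los X K (phi : formula io X K) (f : powers X) :
  formula_eval phi (at_index f i) @[i --> U] --> eval_ultra phi (env_cls f).
Proof.
rewrite /eval_ultra; elim: phi f => {X K} [X s t1 t2|X P t|X n u K uc psi ih
  |X s K K0 psi ih|X s K K0 psi ih] f.
- rewrite /= !term_eval_ultra; apply/iota_cvg.
  exact: cvg_mdist_ultra_class.
- rewrite /=.
  rewrite (_ : (fun j => @term_eval R L ultra_structure X (env_cls f) _ (t j)) =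
    env_cls (fun j i => term_eval (at_index f i) (t j))).
    exact: ultra_pval_cls.
  by apply: functional_extensionality_dep => j; exact: term_eval_ultra.
- rewrite /=; apply: continuous_cvg; first exact: uc.
  by apply: cvg_row => j; exact: ih.
- have [B [r [r' [rE r'E rB r'B rr']]]] := los_quantifier f K0 ih.
  rewrite /= r'E; under eq_fun do rewrite rE.
  apply/iota_cvg.
  apply: (@sup_cvg_along _ _ _ _ U _ (@ucls s) r r' B _ _ _ _ rr').
  + exact: carrier_inhabited.
  + exact: ucls_surj.
  + by move=> i c; case/andP: (rB i c).
  + by move=> c; case/andP: (r'B c).
- have [B [r [r' [rE r'E rB r'B rr']]]] := los_quantifier f K0 ih.
  rewrite /= r'E; under eq_fun do rewrite rE.
  apply/iota_cvg.
  apply: (@inf_cvg_along _ _ _ _ U _ (@ucls s) r r' 0 _ _ _ _ rr').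
  + exact: carrier_inhabited.
  + exact: ucls_surj.
  + by move=> i c; case/andP: (rB i c).
  + by move=> c; case/andP: (r'B c).
Qed.

(** On constant families the values in Los's theorem are constant, so uniqueness of limits gives
    equality. *)
Lemma ultra_emb_eval X K (phi : formula io X K) (a : tuples N X) :
  eval_ultra phi (env_map (fun s c => ucls (fun=> c)) a) = formula_eval phi a.
Proof.
have := @los X K phi (fun j _ => a j).
rewrite (_ : (fun i => _) = fun=> formula_eval phi a) // => los_a.
exact: (cvg_unique (@norm_hausdorff _ _) los_a (cvg_cst _)).
Qed.

Definition ultra_ext : elem_ext io N ultra_structure := ElemExt ultra_emb_eval.

End UltraStructure.

(** * Ultralimit types and the extension of [p] *)

Section Realization.
Variables (R : realType) (io : real_copy R) (L : language R) (N : structure L).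
Variables (X Y : ctx (lsort L)) (K : set (linfty R)).
Variable phi : formula io (ctx_join X Y) K.
Variables (I : Type) (U : set_system I) (a : I -> tuples N X).

Lemma ultralimit_type : UltraFilter U ->
  exists q : phi_type phi N, forall b : tuples N Y,
    formula_eval phi (env_join (a i) b) @[i --> U] --> q b.
Proof.
move=> UU; pose d : powers N I X := fun j i => a i j.
pose val (b : tuples N Y) := @formula_eval _ _ _ (ultra_structure N UU) _ _ phi
  (env_join (env_cls UU d) (env_map (ultra_ext N UU io) b)).
have realized : exists (N' : structure L) (h : elem_ext io N N')
    (c : tuples N' X), forall b : tuples N Y,
    val b = formula_eval phi (env_join c (env_map h b)).
  by exists (ultra_structure N UU), (ultra_ext N UU io), (env_cls UU d).
exists (PhiType realized) => b /=.
(* Parameters enter as constant families, so the joined tuple is the class of a single element of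
   [powers] and Los's theorem applies to it. *)
pose db : powers N I (ctx_join X Y) :=
  env_join (T := fun s => I -> carrier N s) d (fun j _ => b j).
rewrite /val (_ : env_join _ _ = env_cls UU db); last first.
  by apply: functional_extensionality_dep => -[].
rewrite (_ : (fun i => _) = fun i => formula_eval phi (at_index db i)).
  exact: los.
apply/funext => i; congr formula_eval.
by apply: functional_extensionality_dep => -[].
Qed.

End Realization.

(** The sets [close n b d] are a base of a filter, proper by finite satisfiability. Those with a
    single parameter force convergence to [p b] along any finer ultrafilter. *)
Lemma finitely_satisfiable_ultrafilter (R : realType) (io : real_copy R)
    (L : language R) (M N : structure L) (X Y : ctx (lsort L))
    (K : set (linfty R)) (phi : formula io (ctx_join X Y) K)
    (h : elem_ext io M N) (p : phi_type phi N) :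
  finitely_satisfiable h p ->
  exists2 U : set_system (tuples M X), UltraFilter U & forall b,
    formula_eval phi (env_join (env_map h a) b) @[a --> U] --> p b.
Proof.
move=> fs.
pose close n (b : 'I_n -> tuples N Y) d := [set a : tuples M X | forall i,
  `|formula_eval phi (env_join (env_map h a) (b i)) - p (b i)| < d].
pose F : set_system (tuples M X) := [set A |
  exists n (b : 'I_n -> tuples N Y) d, 0 < d /\ close n b d `<=` A].
have PF : ProperFilter F.
  apply: Build_ProperFilter => [[n [b [d [d0 +]]]]|].
    by have [a ba] := fs n b d d0; exact.
  split.
  - have b0 : 'I_0 -> tuples N Y by case.
    by exists 0%N, b0, 1.
  - move=> A B [n [b [d [d0 dA]]]] [m [c [e [e0 eB]]]].
    (* Two conditions are merged by concatenating their parameters and taking the smaller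
       tolerance. *)
    pose bc (i : 'I_(n + m)) :=
      match fintype.split i with inl j => b j | inr j => c j end.
    exists (n + m)%N, bc, (Num.min d e); split; first by rewrite lt_min d0.
    move=> a bca; split; [apply: dA => i|apply: eB => i].
    + have := bca (lshift m i).
      by rewrite /bc (unsplitK (inl i)) lt_min => /andP[].
    + have := bca (rshift n i).
      by rewrite /bc (unsplitK (inr i)) lt_min => /andP[].
  - by move=> A B AB [n [b [d [d0 dA]]]]; exists n, b, d; split=> // a /dA/AB.
have [U [UU FU]] := ultraFilterLemma PF; exists U => // b.
apply/cvgrPdist_lt => e e0; apply: FU; exists 1, (fun=> b), e; split => // a.
by move=> /(_ ord0)/=; rewrite distrC.
Qed.

Theorem proposition3p8 (R : realType) (io : real_copy R) (L : language R)
    (M N0 N : structure L) (X Y : ctx (lsort L)) (K : set (linfty R))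
    (phi : formula io (ctx_join X Y) K)
    (g : elem_ext io M N0) (h : elem_ext io N0 N) (p : phi_type phi N0) :
  finitely_satisfiable g p ->
  exists q : phi_type phi N,
    extends h p q /\ finitely_satisfiable (elem_ext_comp g h) q.
Proof.
move=> /finitely_satisfiable_ultrafilter[U UU pU].
have [q qU] := @ultralimit_type R io L N X Y K phi _ U
  (env_map (elem_ext_comp g h) (X := X)) UU.
exists q; split=> [b|n b d d0].
  (* At parameters from [N0], elementarity of [h] turns the values in [N] into values in [N0], which
     converge to [p b]. *)
  apply: (cvg_unique (@norm_hausdorff _ _) (qU (env_map h b))).
  rewrite (_ : (fun a => _) = fun a : tuples M X =>
    formula_eval phi (env_join (env_map g a) b)); first exact: pU.
  apply/funext => a; rewrite -(emb_eval h); congr formula_eval.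
  by apply: functional_extensionality_dep => -[].
(* The ultrafilter lives on tuples of [M], so a common element of finitely many of its sets is the
   required tuple. *)
apply: (@filter_ex _ U); apply: filter_forall => i.
by have /cvgrPdist_lt/(_ d d0) := qU (b i); apply: filterS => a; rewrite distrC.
Qed.
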